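(* Let $Y$ be a geometric random variable with success probability $p_1\in(0,1)$, put $q_1=1-p_1$, let $0<q<1$, $x\in[0,1]$, and let $n,r$ be integers with $0\le r\le n$. Then $$(-1)^{n-r}B_{r,n}^{Y}(x,q)=[x]_q^{r}\binom{n}{r}H_{n-r}^{(1-[x]_{q^{-1}})}(q_1).$$
   Context: $q$-numbers: $[x]_q=\frac{q^x-1}{q-1}$ and $[x]_{q^{-1}}=\frac{q^{-x}-1}{q^{-1}-1}$; one has $[1-x]_q=1-[x]_{q^{-1}}$. Probabilistic $q$-Bernstein polynomials $B_{r,n}^Y(x,q)$ associated with $Y$: $\sum_{n=r}^{\infty}B_{r,n}^{Y}(x,q)\frac{v^n}{n!}=\frac{(v[x]_q)^r}{r!}\left(\mathrm{E}[e^{vY}]\right)^{[1-x]_q}$, where the power is the power series in $v$ with constant term $1$. For the geometric distribution, $P(Y=y)=p_1(1-p_1)^{y-1}$ for $y=1,2,\dots$ and $\mathrm{E}[e^{vY}]=\frac{p_1e^v}{1-(1-p_1)e^v}$ for $v$ near $0$. Frobenius–Euler numbers of real order $s$: for $u\ne1$, $\sum_{n=0}^{\infty}H_n^{(s)}(u)\frac{v^n}{n!}=\left(\frac{1-u}{e^v-u}\right)^{s}$ (power series with constant term $1$). *)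

(* Defs.v *)
From HB Require Import structures.
From mathcomp Require Import all_boot all_order all_algebra.
From mathcomp Require Import all_classical all_reals all_analysis.

Set Implicit Arguments.
Unset Strict Implicit.
Unset Printing Implicit Defensive.

Import Order.TTheory GRing.Theory Num.Theory.
Import numFieldNormedType.Exports.

Local Open Scope classical_set_scope.
Local Open Scope ring_scope.

(* With q^-1 in place of q this is [x]_{q^-1}, since (q^-1) `^ x = q `^ (- x)
   for q > 0. *)
Definition qnum (R : realType) (q x : R) : R := (q `^ x - 1) / (q - 1).

(* sum_(k >= r) a_k v^k / k! = f v for all v near 0. *)
Definition has_egf (R : realType) (r : nat) (f : R -> R) (a : nat -> R) : Prop :=
  \forall v \near (0 : R),
    \sum_(r <= k < N) a k * (v ^+ k / k`!%:R) @[N --> \oo] --> f v.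

(* The coefficients a_k for k >= r; they are determined by f as soon as f has
   such an expansion, and the entries below r are irrelevant. *)
Definition egf_coef (R : realType) (r : nat) (f : R -> R) : nat -> R :=
  get [set a | has_egf r f a].

Definition geometric_rv (R : realType) (d : measure_display)
    (T : measurableType d) (P : probability T R) (Y : {RV P >-> R})
    (p : R) : Prop :=
  forall y : nat, (1 <= y)%N ->
    P [set w | Y w = y%:R] = (p * (1 - p) ^+ (y - 1))%:E.

(* 'M_P Y v = E[e^{vY}] is 1 at v = 0, so if it is finite and analytic near 0,
   its real power [`^] is given there by the power series with constant
   term 1. *)
Definition qbernstein_gf (R : realType) (d : measure_display)
    (T : measurableType d) (P : probability T R) (Y : {RV P >-> R})
    (r : nat) (x q v : R) : R :=
  (v * qnum q x) ^+ r / r`!%:R * fine ('M_P Y v) `^ qnum q (1 - x).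

Definition qbernstein (R : realType) (d : measure_display)
    (T : measurableType d) (P : probability T R) (Y : {RV P >-> R})
    (r n : nat) (x q : R) : R :=
  egf_coef r (qbernstein_gf Y r x q) n.

(* For u <> 1 the base of the power is 1 at v = 0, hence positive near 0. *)
Definition frobenius_euler_gf (R : realType) (s u v : R) : R :=
  ((1 - u) / (expR v - u)) `^ s.

Definition frobenius_euler (R : realType) (s u : R) (n : nat) : R :=
  egf_coef 0 (frobenius_euler_gf s u) n.

(* Main.v *)
Require Import Defs.
From HB Require Import structures.
From mathcomp Require Import all_boot all_order all_algebra.
From mathcomp Require Import all_classical all_reals all_analysis.
From mathcomp Require Import measurable_realfun.
From mathcomp Require Import ring lra.

Set Implicit Arguments.
Unset Strict Implicit.
Unset Printing Implicit Defensive.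

Import Order.TTheory GRing.Theory Num.Theory.
Import numFieldNormedType.Exports.

Local Open Scope classical_set_scope.
Local Open Scope ring_scope.

(* Write s = [1-x]_q = 1 - [x]_{1/q}, which lies in [0, 1]. The moment generating
   function of Y is p1 e^v / (1 - q1 e^v) near 0, and evaluated at -v it is
   (1 - q1) / (e^v - q1), the base of the Frobenius-Euler generating function.
   So both generating functions come from the one function
   g v = (p1 e^v / (1 - q1 e^v))^s, up to v |-> -v and the factor
   (v [x]_q)^r / r!, and comparing coefficients gives the identity.
   What has to be shown is that g is analytic at 0. The binomial series turns g
   into a series of exponentials with nonnegative weights,
   g v = \sum_j c_j e^{(s + j) v}, and each exponential is replaced by its
   Taylor polynomial with an error that is summable in j and tends to 0. *)

(** * Power series: termwise differentiation and uniqueness of coefficients *)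

Lemma is_cvg_pseries_natX (R : realType) (z : R) :
  `|z| < 1 -> cvgn (pseries (fun n => n.+1%:R) z).
Proof.
move=> z1; apply: normed_cvg.
pose t := `|z|; rewrite -/t in z1.
have t0 : 0 <= t by exact: normr_ge0.
(* Closed form of the partial sums at [t]; it is at most 1, so the partial sums are bounded by (1 -
   t)^-2. *)
have E N : \sum_(0 <= i < N) (i.+1%:R * t ^+ i) * (1 - t) ^+ 2 =
    1 - (N.+1%:R * t ^+ N - N%:R * t ^+ N.+1) :> R.
  elim: N => [|N IH]; first by rewrite big_nil expr0; ring.
  rewrite big_nat_recr//= IH !exprS -!natr1; ring.
apply: nondecreasing_is_cvgn.
  by apply: nondecreasing_series => n _ _; rewrite normr_ge0.
exists ((1 - t) ^- 2) => _ [N _ <-].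
rewrite -[leRHS]mul1r ler_pdivlMr ?exprn_gt0 ?subr_gt0// /series/=.
rewrite mulr_suml.
under eq_bigr do rewrite normrM normr_nat normrX -/t.
rewrite E lerBlDr lerDl subr_ge0 exprS mulrA ler_wpM2r ?exprn_ge0//.
apply: (@le_trans _ _ N%:R); last by rewrite ler_nat.
by rewrite ler_piMr// ltW.
Qed.

(** Convergence at [x] bounds the terms f_n x^n by a constant M. Hence the n-th term of the
    differentiated series at [z] is at most M / |x| times (n + 1) |z / x|^n, and |z / x| < 1. *)
Lemma is_cvg_pseries_diffs (R : realType) (f : R^nat) (x z : R) :
  cvgn (pseries f x) -> `|z| < `|x| -> cvgn (pseries (pseries_diffs f) z).
Proof.
move=> Cx zx; have x0 : 0 < `|x| by rewrite (le_lt_trans _ zx).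
have [K [Kreal Kf]] := cvg_series_bounded Cx.
have {}Kf n : `|f n * x ^+ n| <= `|K| + 1.
  by apply: Kf => //; rewrite (le_lt_trans (ler_norm K))// ltrDl.
have t1 : `|z / x| < 1 by rewrite normrM normfV ltr_pdivrMr ?mul1r.
apply: normed_cvg.
apply: (@series_le_cvg _ _
    (fun n => (`|K| + 1) / `|x| * (n.+1%:R * `|z / x| ^+ n))) => [n|n|n|].
- by rewrite normr_ge0.
- by rewrite !mulr_ge0 ?addr_ge0.
- rewrite /= /pseries_diffs !normrM normr_nat.
  have -> : `|f n.+1| = `|f n.+1 * x ^+ n.+1| / `|x| ^+ n.+1.
    by rewrite normrM normrX mulfK// expf_neq0// gt_eqF.
  rewrite normfV exprMn exprVn normrX (exprS `|x|) invfM.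
  set a := `|_ * _|; rewrite [leLHS](_ : _ =
    a * (`|x|^-1 * (n.+1%:R * (`|z| ^+ n * `|x| ^- n)))); last by ring.
  by rewrite -mulrA ler_wpM2r ?Kf// !mulr_ge0 ?invr_ge0 ?exprn_ge0.
- apply: is_cvg_seriesZ; apply: is_cvg_pseries_natX.
  by rewrite normr_id.
Qed.

Lemma is_cvg_pseries_diffs_ball (R : realType) (f : R^nat) (e : R) :
  (forall z, `|z| < e -> cvgn (pseries f z)) ->
  forall z, `|z| < e -> cvgn (pseries (pseries_diffs f) z).
Proof.
move=> fc z ze.
have /andP[zm me] : `|z| < (`|z| + e) / 2 < e by rewrite midf_lt//= midf_lt.
have m0 : `|(`|z| + e) / 2| = (`|z| + e) / 2.
  by rewrite ger0_norm// divr_ge0// addr_ge0// (le_trans _ (ltW ze)).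
apply: (@is_cvg_pseries_diffs _ _ ((`|z| + e) / 2)); last by rewrite m0.
by apply: fc; rewrite m0.
Qed.

(** [pseries_snd_diffs] asks for convergence of the series and of its first two formal derivatives
    at a point farther from 0 than [x]; the midpoint of |x| and [e] serves. *)
Lemma is_derive_pseries (R : realType) (f : R^nat) (e x : R) :
  (forall z, `|z| < e -> cvgn (pseries f z)) -> `|x| < e ->
  is_derive x 1 (fun x => limn (pseries f x))
    (limn (pseries (pseries_diffs f) x)).
Proof.
move=> fc xe; have dfc := is_cvg_pseries_diffs_ball fc.
have ddfc := is_cvg_pseries_diffs_ball dfc.
have /andP[xm me] : `|x| < (`|x| + e) / 2 < e by rewrite midf_lt//= midf_lt.
have m0 : `|(`|x| + e) / 2| = (`|x| + e) / 2.
  by rewrite ger0_norm// divr_ge0// addr_ge0// (le_trans _ (ltW xe)).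
by apply: (@pseries_snd_diffs _ _ ((`|x| + e) / 2)); rewrite ?m0//;
  [apply: fc|apply: dfc|apply: ddfc]; rewrite m0.
Qed.

(** Induction on [k] for all [f] at once: f_0 is the value at 0, and the formal derivative again
    sums to 0 near 0, with (k + 1) f_(k+1) as its [k]-th coefficient. *)
Lemma pseries0_coef (R : realType) (f : R^nat) :
  (\forall v \near (0 : R), pseries f v @ \oo --> (0 : R)) -> forall k, f k = 0.
Proof.
move=> f0 k; elim: k f f0 => [|k IH] f [e /= e0 fe].
  have := fe 0; rewrite /= subrr normr0 => /(_ e0) f0.
  have : pseries f 0 @ \oo --> f 0%N.
    (* At 0 every partial sum except the empty one equals f_0, hence the shift by 1. *)
    rewrite -(cvg_shiftn 1); apply: cvg_near_cst; apply: nearW => n.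
    rewrite /pseries /series/= addn1 big_nat_recl//= expr0 mulr1 big1 ?addr0//.
    by move=> i _; rewrite expr0n/= mulr0.
  by move=> /cvg_unique; apply.
have {}fe z : `|z| < e -> pseries f z @ \oo --> (0 : R).
  by move=> ze; apply: fe; rewrite /= sub0r normrN.
have : pseries_diffs f k = 0.
  apply: IH; exists (e / 2) => /=; first by rewrite divr_gt0.
  move=> v /=; rewrite sub0r normrN => ve2.
  have ve : `|v| < e by rewrite (lt_trans ve2)// ltr_pdivrMr// ltr_pMr// ltr1n.
  have dv : is_derive v 1 (fun x => limn (pseries f x))
      (limn (pseries (pseries_diffs f) v)).
    by apply: (is_derive_pseries _ ve) => z /fe /cvgP.
  have d0 : is_derive v 1 (fun x => limn (pseries f x)) 0.
    apply: (@near_eq_is_derive _ _ _ (cst 0)) => //.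
    near=> w; apply/esym/cvg_lim => //; apply: fe.
    near: w; apply: cvgr_lt ve.
    exact: norm_continuous.
  rewrite -(@derive_val _ _ _ _ _ _ _ d0) (@derive_val _ _ _ _ _ _ _ dv).
  by apply: (is_cvg_pseries_diffs_ball _ ve) => z /fe /cvgP.
by rewrite /pseries_diffs => /eqP; rewrite mulf_eq0 pnatr_eq0/= => /eqP.
Unshelve. all: by end_near. Qed.

(** * Exponential generating functions: uniqueness, operations, series of exponentials *)

Lemma egf_unique (R : realType) (r : nat) (f : R -> R) (a b : R^nat) (k : nat) :
  has_egf r f a -> has_egf r f b -> (r <= k)%N -> a k = b k.
Proof.
move=> fa fb rk.
(* The difference becomes an ordinary power series starting at 0: the factorial goes into the
   coefficient, and the entries below [r], about which [has_egf] says nothing, are set to 0. *)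
suff /(_ k) : forall k,
    (fun k => if (r <= k)%N then (a k - b k) / k`!%:R else 0) k = 0 :> R.
  rewrite /= rk => /eqP; rewrite mulf_eq0 invr_eq0 pnatr_eq0.
  by rewrite gtn_eqF ?fact_gt0// orbF subr_eq0 => /eqP.
apply: pseries0_coef; near=> v.
have va : \sum_(r <= k < N) a k * (v ^+ k / k`!%:R) @[N --> \oo] --> f v.
  by near: v; exact: fa.
have vb : \sum_(r <= k < N) b k * (v ^+ k / k`!%:R) @[N --> \oo] --> f v.
  by near: v; exact: fb.
rewrite -(subrr (f v)); apply: cvg_trans (cvgB va vb); apply: near_eq_cvg.
apply: nearW => N; rewrite /pseries/series/= !fctE -sumrB.
rewrite (big_nat_widenl _ 0)// big_mkcond/=.
by apply: eq_bigr => i _; case: ifP => _; [field|ring].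
Unshelve. all: by end_near. Qed.

Lemma egf_coefE (R : realType) (r : nat) (f : R -> R) (a : R^nat) (k : nat) :
  has_egf r f a -> (r <= k)%N -> egf_coef r f k = a k.
Proof.
move=> fa rk; apply: (egf_unique _ fa rk).
by apply: (@getPex _ [set a | has_egf r f a]); exists a.
Qed.

Lemma has_egf_near (R : realType) (r : nat) (f g : R -> R) (a : R^nat) :
  (\forall v \near (0 : R), f v = g v) -> has_egf r f a -> has_egf r g a.
Proof. by move=> fg; apply: filterS2 fg => v ->. Qed.

Lemma has_egf_opp (R : realType) (f : R -> R) (a : R^nat) :
  has_egf 0 f a -> has_egf 0 (fun v => f (- v)) (fun k => (-1) ^+ k * a k).
Proof.
move=> fa; have : \forall v \near (0 : R), \sum_(0 <= k < N)
    a k * ((- v) ^+ k / k`!%:R) @[N --> \oo] --> f (- v).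
  have opp0 : - v @[v --> (0 : R)] --> (0 : R).
    by rewrite -[X in _ --> X]oppr0; exact: oppr_continuous.
  exact: opp0 fa.
apply: filterS => v fv; apply: cvg_trans fv; apply: near_eq_cvg.
by apply: nearW => N; apply: eq_bigr => k _; rewrite exprNn; ring.
Qed.

Lemma has_egf_mul_monomial (R : realType) (r : nat) (c : R) (f : R -> R)
    (a : R^nat) :
  has_egf 0 f a ->
  has_egf r (fun v => (v * c) ^+ r / r`!%:R * f v)
    (fun k => c ^+ r * 'C(k, r)%:R * a (k - r)%N).
Proof.
apply: filterS => v fv.
(* Shifting the bound by [r] gives both partial sums [N] terms; the binomial coefficient then comes
   from (k + r)! / (r! k!). *)
rewrite -(cvg_shiftn r (fun N => \sum_(r <= k < N) _)) /=.
apply: cvg_trans (cvgMl_tmp (a := (v * c) ^+ r / r`!%:R) fv).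
apply: near_eq_cvg; apply: nearW => N.
rewrite mulr_sumr (big_addn 0 _ r) addnK; apply: eq_bigr => k _.
rewrite addnK exprMn exprD.
have <- : 'C(k + r, r)%:R * r`!%:R * k`!%:R = (k + r)`!%:R :> R.
  by rewrite -!natrM -(bin_fact (leq_addl k r)) addnK mulnA.
by field; rewrite !pnatr_eq0 -!lt0n !fact_gt0 bin_gt0 leq_addl.
Qed.

(* For [k >= N], the [k]-th term at [|y|] is [2 ^- k <= 2 ^- N] times the one at
   [2 |y|]. *)
Lemma expR_taylor_remainder (R : realType) (y : R) (N : nat) :
  `|expR y - \sum_(0 <= k < N) y ^+ k / k`!%:R| <= 2^-1 ^+ N * expR (2 * `|y|).
Proof.
have cvge := @is_cvg_series_exp_coeff R y.
have cvgs : `|series (exp_coeff y) M - \sum_(0 <= k < N) y ^+ k / k`!%:R|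
    @[M --> \oo] --> `|expR y - \sum_(0 <= k < N) y ^+ k / k`!%:R|.
  by apply: cvg_norm; apply: cvgB => //; exact: cvg_cst.
rewrite -(cvg_lim _ cvgs)//.
apply: limr_le; first by apply: cvgP cvgs.
near=> M.
have NM : (N <= M)%N by near: M; exact: nbhs_infty_ge.
rewrite [series _]/series /exp_coeff/= (big_cat_nat (leq0n N) NM)//=.
rewrite addrAC subrr add0r.
apply: (le_trans (ler_norm_sum _ _ _)).
apply: (@le_trans _ _ (2^-1 ^+ N * \sum_(N <= i < M) exp_coeff (2 * `|y|) i)).
  rewrite mulr_sumr; apply: ler_sum_nat => i /andP[Ni _].
  rewrite /exp_coeff/= normrM normrX normfV normr_nat mulrA.
  rewrite ler_wpM2r ?invr_ge0// exprMn mulrA ler_peMl ?exprn_ge0//.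
  rewrite exprVn -(subnK Ni) exprD mulrC mulfK.
    by rewrite exprn_ege1// ler1n.
  by rewrite expf_neq0// pnatr_eq0.
rewrite ler_wpM2l ?exprn_ge0 ?invr_ge0//.
have e0 i : 0 <= exp_coeff (2 * `|y|) i by rewrite exp_coeff_ge0// mulr_ge0.
apply: (@le_trans _ _ (series (exp_coeff (2 * `|y|)) M)).
  by rewrite /series/= (big_cat_nat (leq0n N) NM)//= lerDr sumr_ge0.
apply: nondecreasing_cvgn_le; last exact: is_cvg_series_exp_coeff.
by apply: nondecreasing_series => *; exact: e0.
Unshelve. all: by end_near. Qed.

(** The coefficients are the moments \sum_j c_j l_j^k. As c_j and l_j are nonnegative, the Taylor
    remainder of c_j e^(l_j v) after [N] terms is at most 2^-N c_j e^(2 l_j |v|). Summed over j,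
    this is 2^-N g(2|v|), which tends to 0. *)
Lemma has_egf_expR_series (R : realType) (c l : R^nat) (g : R -> R) :
  (forall j, 0 <= c j) -> (forall j, 0 <= l j) ->
  (\forall v \near (0 : R),
    series (fun j => c j * expR (l j * v)) @ \oo --> g v) ->
  has_egf 0 g (fun k => limn (series (fun j => c j * l j ^+ k))).
Proof.
move=> c0 l0 [e /= e0 ge].
have {}ge v : `|v| < e -> series (fun j => c j * expR (l j * v)) @ \oo --> g v.
  by move=> ve; apply: ge; rewrite /= sub0r normrN.
have cvgk k : cvgn (series (fun j => c j * l j ^+ k)).
  (* Each moment converges by comparison at the point e/2 of the disc: l^k is k! / (e/2)^k times the
     [k]-th term of the exponential series at l e/2, so at most that factor times e^(l e/2). *)
  have e2 : 0 < e / 2 by rewrite divr_gt0.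
  apply: (@series_le_cvg _ _
      (fun j => k`!%:R / (e / 2) ^+ k * (c j * expR (l j * (e / 2)))))
    => [j|j|j|].
  - by rewrite mulr_ge0 ?exprn_ge0.
  - by rewrite !mulr_ge0 ?expR_ge0 ?invr_ge0 ?exprn_ge0 ?(ltW e2).
  - rewrite mulrCA ler_wpM2l//.
    have -> : l j ^+ k = k`!%:R / (e / 2) ^+ k * exp_coeff (l j * (e / 2)) k.
      rewrite /exp_coeff/= (exprMn _ (l j)).
      by field; rewrite expf_neq0 ?gt_eqF//= pnatr_eq0 -lt0n fact_gt0.
    rewrite ler_wpM2l ?mulr_ge0 ?invr_ge0 ?exprn_ge0 ?(ltW e2)//.
    have le0 i : 0 <= exp_coeff (l j * (e / 2)) i.
      by rewrite exp_coeff_ge0// mulr_ge0// ltW.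
    apply: (@le_trans _ _ (series (exp_coeff (l j * (e / 2))) k.+1)).
      by rewrite /series/= big_nat_recr//= lerDr sumr_ge0.
    apply: nondecreasing_cvgn_le; last exact: is_cvg_series_exp_coeff.
    by apply: nondecreasing_series => *; exact: le0.
  - apply: is_cvg_seriesZ; apply/cvgP/ge.
    by rewrite gtr0_norm// ltr_pdivrMr// ltr_pMr// ltr1n.
near=> v.
(* The error bound evaluates [g] at 2|v|, which must stay in the disc. *)
have v2 : `|2 * `|v| | < e.
  rewrite normrM normr_id normr_nat mulrC -ltr_pdivlMr//.
  near: v; exists (e / 2); first by rewrite /= divr_gt0.
  by move=> w; rewrite /= sub0r normrN.
have v1 : `|v| < e.
  by apply: le_lt_trans v2; rewrite normrM normr_id normr_nat ler_peMl// ler1n.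
pose h k := limn (series (fun j => c j * l j ^+ k)).
pose B := g (2 * `|v|).
have bound N :
    `|g v - \sum_(0 <= k < N) h k * (v ^+ k / k`!%:R)| <= 2^-1 ^+ N * B.
  (* Exchange of the series over j with the finite sum over k. *)
  have hN : \sum_(0 <= j < J) c j * \sum_(0 <= k < N) (l j * v) ^+ k / k`!%:R
      @[J --> \oo] --> \sum_(0 <= k < N) h k * (v ^+ k / k`!%:R).
    have : \sum_(0 <= k < N)
          (series (fun j => c j * l j ^+ k) J * (v ^+ k / k`!%:R))
        @[J --> \oo] --> \sum_(0 <= k < N) h k * (v ^+ k / k`!%:R).
      apply: cvg_big => [|k _]; first exact: add_continuous.
      by apply: cvgMr_tmp; exact: cvgk.
    apply: cvg_trans; apply: near_eq_cvg; apply: nearW => J.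
    under [RHS]eq_bigr do rewrite mulr_sumr.
    rewrite [RHS]exchange_big/=; apply: eq_bigr => k _.
    rewrite /series/= mulr_suml; apply: eq_bigr => j _.
    by rewrite exprMn; ring.
  have /(_ _ _) L := cvg_norm (cvgB (ge v v1) hN).
  rewrite -(cvg_lim _ L)//.
  have U : 2^-1 ^+ N * series (fun j => c j * expR (l j * (2 * `|v|))) J
     @[J --> \oo] --> 2^-1 ^+ N * B by apply: cvgMl_tmp; exact: ge.
  rewrite -[leRHS](cvg_lim _ U)//.
  apply: ler_lim; [exact: cvgP L|exact: cvgP U|apply: nearW => J].
  rewrite /series/= !fctE -sumrB mulr_sumr.
  apply: (le_trans (ler_norm_sum _ _ _)); apply: ler_sum => j _.
  rewrite -mulrBr normrM ger0_norm// mulrCA ler_wpM2l//.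
  have := expR_taylor_remainder (l j * v) N.
  by rewrite normrM (ger0_norm (l0 j)) (mulrCA 2).
apply/cvgrPdist_le => eps eps0.
have : 2^-1 ^+ N * B @[N --> \oo] --> 0.
  rewrite -(mul0r B); apply: cvgMr_tmp; apply: cvg_expr.
  by rewrite gtr0_norm ?invr_gt0// invf_lt1// ltr1n.
move/cvgrPdist_le => /(_ _ eps0); apply: filterS => N.
rewrite sub0r normrN => BN; apply: le_trans (bound N) _.
exact: le_trans (ler_norm _) BN.
Unshelve. all: by end_near. Qed.

(** * The binomial series with exponent -s *)

(** This is s (s + 1) ... (s + j - 1) / j!, the coefficient of z^j in (1 - z)^(-s). *)
Definition rising_binomial (R : realType) (s : R) (j : nat) : R :=
  \prod_(i < j) ((s + i%:R) / i.+1%:R).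

Lemma pseries_diffs_rising_binomial (R : realType) (s : R) :
  pseries_diffs (rising_binomial s) =
    (fun j => (s + j%:R) * rising_binomial s j).
Proof.
apply/funext => j; rewrite /pseries_diffs /rising_binomial big_ord_recr/=.
by field; rewrite addrC natr1 pnatr_eq0.
Qed.

Lemma rising_binomial_ge0 (R : realType) (s : R) (j : nat) :
  0 <= s -> 0 <= rising_binomial s j.
Proof.
by move=> s0; rewrite prodr_ge0// => i _; rewrite divr_ge0 ?addr_ge0.
Qed.

Lemma rising_binomial_le1 (R : realType) (s : R) (j : nat) :
  0 <= s <= 1 -> rising_binomial s j <= 1.
Proof.
move=> /andP[s0 s1]; apply: prodr_ile1 => i _.
by rewrite divr_ge0 ?addr_ge0//= ler_pdivrMr// mul1r -nat1r lerD2r.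
Qed.

(** For [s] in [0, 1] the coefficients lie in [0, 1], so the geometric series dominates. *)
Lemma is_cvg_pseries_rising_binomial (R : realType) (s z : R) :
  0 <= s <= 1 -> `|z| < 1 -> cvgn (pseries (rising_binomial s) z).
Proof.
move=> s01 z1; apply: normed_cvg.
apply: (@series_le_cvg _ _ (geometric 1 `|z|)) => [j|j|j|].
- exact: normr_ge0.
- by rewrite /= mul1r exprn_ge0.
- rewrite /= normrM normrX ler_wpM2r ?exprn_ge0//.
  have /andP[s0 _] := s01.
  by rewrite ger0_norm ?rising_binomial_le1 ?rising_binomial_ge0.
- by apply: is_cvg_geometric_series; rewrite normr_id.
Qed.

(* With F the sum of the series, (1 - z) F' = s F, so F (1 - z)^s is constant. *)
Lemma cvg_pseries_rising_binomial (R : realType) (s z : R) :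
  0 <= s <= 1 -> `|z| < 1 ->
  pseries (rising_binomial s) z @ \oo --> (1 - z) `^ (- s).
Proof.
move=> s01 z1; set c := rising_binomial s.
pose F (z : R) : R := limn (pseries c z).
pose D (z : R) : R := limn (pseries (pseries_diffs c) z).
have Fc (w : R) : `|w| < 1 -> cvgn (pseries c w).
  exact: is_cvg_pseries_rising_binomial.
have dF (w : R) : `|w| < 1 -> is_derive w 1 F (D w) by exact: is_derive_pseries.
have ode (w : R) : `|w| < 1 -> (1 - w) * D w = s * F w.
  move=> w1.
  have Dc : cvgn (pseries (pseries_diffs c) w).
    exact: is_cvg_pseries_diffs_ball Fc _ w1.
  (* [pseries_diffs_equiv] writes the derivative as \sum_i i c_i w^(i-1). The factor [w] restores
     w^i, and the recurrence (i + 1) c_(i+1) = s c_i + i c_i then applies termwise. *)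
  have /(_ _) Dc' := cvgMr_tmp (b := w) (pseries_diffs_equiv Dc).
  have sF : s * pseries c w N @[N --> \oo] --> s * F w.
    by apply: cvgMl_tmp; exact: Fc.
  have : pseries (pseries_diffs c) w @ \oo --> s * F w + D w * w.
    apply: cvg_trans (cvgD sF Dc'); apply: near_eq_cvg; apply: nearW => N.
    rewrite /pseries /series/= !fctE mulr_sumr mulr_suml -big_split/=.
    apply: eq_bigr => -[|i] _; rewrite /c pseries_diffs_rising_binomial/= ?exprS;
      ring.
  move=> /cvg_lim; rewrite -/(D w) => DE.
  have {}DE := DE (@norm_hausdorff _ _).
  rewrite mulrBl mul1r {1}DE; ring.
pose G (w : R) : R := F w * (1 - w) `^ s.
have dG (w : R) : `|w| < 1 -> is_derive w 1 G 0.
  move=> w1; have w0 : 0 < 1 - w by rewrite subr_gt0 ltr_normlW.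
  have dw : is_derive w 1 (fun w : R => 1 - w) (-1).
    have := is_deriveB (is_derive_cst (1 : R) w (1 : R)) (is_derive_id w (1 : R)).
    by rewrite sub0r.
  have dp := @is_derive1_comp _ (fun y : R => y `^ s) (fun w : R => 1 - w) w _ _
    (is_derive1_powR s w0) dw.
  have dFp : is_derive w 1 G _ := is_deriveM (dF _ w1) dp.
  apply: is_derive_eq.
  rewrite /= /GRing.scale/=.
  (* Splitting off one factor 1 - w lets [ode] cancel the two terms of the product rule. *)
  have -> : (1 - w) `^ s = (1 - w) * (1 - w) `^ (s - 1).
    rewrite -[X in X * _]powRr1 ?ltW// -powRD.
      by rewrite (addrC 1 (s - 1)) subrK.
    by rewrite (gt_eqF w0) implybT.
  by rewrite [X in _ + X]mulrAC ode//; ring.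
have Gcst (a b : R) : -1 < a -> a <= b -> b < 1 -> G a = G b.
  move=> a1 ab b1.
  have ab1 (w : R) : w \in `[a, b] -> `|w| < 1.
    rewrite in_itv/= ltr_norml => /andP[aw wb].
    by rewrite (lt_le_trans a1 aw) (le_lt_trans wb b1).
  have dab (w : R) : w \in `]a, b[ -> is_derive w 1 G (cst 0 w).
    by move=> /subset_itv_oo_cc wab; apply/dG/ab1.
  have cab : {within `[a, b], continuous G}.
    apply: derivable_within_continuous => w /ab1 /dG dGw; exact: ex_derive.
  by have [w _] := MVT_segment ab dab cab; rewrite mul0r => /subr0_eq.
have G0 : G 0 = 1.
  rewrite /G subr0 powR1 mulr1; apply/cvg_lim => //.
  rewrite -(cvg_shiftn 1); apply: cvg_near_cst; apply: nearW => n.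
  rewrite /pseries/series/= addn1 big_nat_recl//= expr0 mulr1 big1 ?addr0//.
    by rewrite /c /rising_binomial big_ord0.
  by move=> i _; rewrite expr0n/= mulr0.
have Gz : G z = 1.
  move: z1; rewrite ltr_norml => /andP[z1 z2].
  by have [z0|/ltW z0] := leP 0 z; rewrite -G0; [apply/esym|]; apply: Gcst;
    rewrite // oppr_lt0.
have nz : (1 - z) `^ s != 0.
  by rewrite gt_eqF// powR_gt0// subr_gt0 ltr_normlW.
have Fz : F z = G z / (1 - z) `^ s by rewrite /G mulfK.
rewrite (_ : (1 - z) `^ (- s) = F z); last by rewrite Fz Gz powRN mul1r.
exact: Fc.
Qed.

(** * The moment generating function of the geometric law *)

(** The hypothesis gives only the masses at the positive integers. They sum to 1, so [Y] takes other
    values on a null set only, and the expectation is a geometric series over the atoms. *)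
Lemma mmt_gen_fun_geometric (R : realType) (d : measure_display)
    (T : measurableType d) (P : probability T R) (Y : {RV P >-> R}) (p v : R) :
  0 < p < 1 ->
  geometric_rv Y p -> (1 - p) * expR v < 1 ->
  'M_P Y v = (p * expR v / (1 - (1 - p) * expR v))%:E.
Proof.
move=> /andP[p0 p1] hY v1.
pose atom (j : nat) : set T := [set w | Y w = j.+1%:R].
have measurable_atom j : measurable (atom j).
  rewrite (_ : atom j = Y @^-1` [set j.+1%:R]); last by apply/seteqP; split.
  by rewrite -[X in measurable X]setTI; exact: measurable_funP.
have trivIset_atom : trivIset setT atom.
  move=> i j _ _ [w []]; rewrite /atom/= => -> /eqP.
  by rewrite eqr_nat eqSS => /eqP.
have PY j : P (atom j) = (p * (1 - p) ^+ j)%:E by rewrite hY// subn1.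
set U := \bigcup_j atom j.
have mU : measurable U by exact: bigcup_measurable.
(* Used twice: with ratio 1 - p for the total mass, and with ratio (1 - p) e^v for the
   expectation. *)
have geo (a z : R) : 0 <= z -> z < 1 ->
    (\sum_(j <oo) (a * z ^+ j)%:E)%E = (a / (1 - z))%:E.
  move=> z0 z1; apply/cvg_lim => //.
  apply: cvg_EFin; first by apply: nearW => N; rewrite sumEFin.
  have zz : `|z| < 1 by rewrite ger0_norm.
  rewrite [X in X @ _ --> _](_ : _ = series (geometric a z)).
    exact: cvg_geometric_series.
  by apply/funext => N; rewrite /= sumEFin.
have q0 : 0 <= 1 - p by rewrite subr_ge0 ltW.
have PU : P (~` U) = 0%E.
  rewrite probability_setC// measure_semi_bigcup//.
  rewrite (eq_eseriesr (fun j _ => PY j)) geo//; last by rewrite ltrBlDr ltrDl.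
  by rewrite subKr divff ?gt_eqF// subee.
pose f (w : T) := (expR (Y w * v))%:E.
have mf : measurable_fun [set: T] f.
  apply/measurable_EFinP; apply: measurableT_comp => //.
  exact: measurable_funM.
rewrite /mmt_gen_fun unlock.
have f0 w : (0 <= f w)%E by rewrite lee_fin expR_ge0.
change (\int[P]_w f w = (p * expR v / (1 - (1 - p) * expR v))%:E)%E.
transitivity (\int[P]_(w in U) f w)%E.
  rewrite -(setUv U) ge0_integral_setU ?setUv//; last 2 first.
    exact: measurableC.
    exact/disj_setPCl.
  rewrite [X in (_ + X)%E](_ : _ = 0%E) ?adde0//.
  apply: null_set_integral => //; first exact: measurableC.
  exact: measurable_funS mf.
rewrite /U ge0_integral_bigcup//; last exact: measurable_funS mf.
rewrite -(geo (p * expR v)); last 2 first.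
  by rewrite mulr_ge0 ?expR_ge0.
  by [].
apply: eq_eseriesr => j _.
rewrite (eq_integral (cst (expR (j.+1%:R * v))%:E)).
  rewrite integral_cst//.
  transitivity ((expR (j.+1%:R * v))%:E * P (atom j))%E => //.
  rewrite PY -EFinM; congr _%:E.
  rewrite expRM_natl exprS exprMn; ring.
by move=> w; rewrite inE /atom/f/= => ->.
Qed.

(** * Identities and bounds for q-numbers *)

Lemma qnum_compl (R : realType) (q x : R) : 0 < q < 1 ->
  qnum q (1 - x) = 1 - qnum q^-1 x.
Proof.
move=> /andP[q0 q1]; rewrite /qnum.
have -> : q^-1 `^ x = (q `^ x)^-1.
  by rewrite -powR_inv1 ?ltW// -powRrM mulN1r powRN.
rewrite powRD ?(gt_eqF q0) ?implybT// powRr1 ?ltW// powRN.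
field; rewrite mulN1r !subr_eq0 (gt_eqF q0) (gt_eqF q1) (lt_eqF q1)/=.
by rewrite gt_eqF// powR_gt0.
Qed.

(** Since q < 1, the power q^x lies between q and 1. Applied to 1 - x, this puts the exponent [s] in
    the range required by the binomial series. *)
Lemma qnum_itv (R : realType) (q x : R) : 0 < q < 1 -> 0 <= x <= 1 ->
  0 <= qnum q x <= 1.
Proof.
move=> /andP[q0 q1] /andP[x0 x1].
rewrite /qnum -opprB -(opprB 1 q) invrN mulrNN.
have q01 : 0 < q <= 1 by rewrite q0 ltW.
have lx : q `^ x <= 1 by rewrite -[leRHS](powRr0 q); exact: (ger_powR q01).
have gx : q <= q `^ x.
  by rewrite -[leLHS](powRr1 (ltW q0)); exact: (ger_powR q01).
rewrite divr_ge0 ?subr_ge0// ?(ltW q1)//= ler_pdivrMr ?subr_gt0// mul1r.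
by rewrite lerD2l lerN2.
Qed.

(** * The expansion of the power of the generating function, and the conclusion *)

Lemma near0_mul_expR_lt1 (R : realType) (a : R) : a < 1 ->
  \forall v \near (0 : R), a * expR v < 1.
Proof.
move=> a1; have : a * expR v @[v --> (0 : R)] --> a * expR 0.
  by apply: cvgMl_tmp; exact: continuous_expR.
by rewrite expR0 mulr1 => /cvgr_lt; apply.
Qed.

(* The weights are those of a negative binomial law shifted by [s]. *)
Lemma cvg_negative_binomial_mgf (R : realType) (p s v : R) :
  0 < p < 1 -> 0 <= s <= 1 -> (1 - p) * expR v < 1 ->
  series (fun j => p `^ s * rising_binomial s j * (1 - p) ^+ j *
                   expR ((s + j%:R) * v)) @ \oo -->
  (p * expR v / (1 - (1 - p) * expR v)) `^ s.
Proof.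
move=> /andP[p0 p1] s01 v1.
have q0 : 0 <= 1 - p by rewrite subr_ge0 ltW.
have z1 : `|(1 - p) * expR v| < 1 by rewrite ger0_norm// mulr_ge0 ?expR_ge0.
(* The factor e^(s v) is kept apart so that it joins (e^v)^j from the binomial series to form e^((s
   + j) v). *)
have -> : (p * expR v / (1 - (1 - p) * expR v)) `^ s =
    p `^ s * expR (s * v) * (1 - (1 - p) * expR v) `^ (- s).
  rewrite powRM ?mulr_ge0 ?expR_ge0 ?(ltW p0) ?invr_ge0 ?subr_ge0 ?(ltW v1)//.
  rewrite powRM ?expR_ge0 ?(ltW p0)// -expRM (mulrC v); congr (_ * _).
  rewrite -powR_inv1 ?subr_ge0 ?(ltW v1)//.
  by rewrite -powRrM mulN1r.
apply: cvg_trans (cvgMl_tmp (cvg_pseries_rising_binomial s01 z1)).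
apply: near_eq_cvg; apply: nearW => N.
rewrite /series/= mulr_sumr; apply: eq_bigr => j _.
by rewrite (mulrDl s) expRD expRM_natl /= exprMn; ring.
Qed.

Theorem theorem3p5 (R : realType) (d : measure_display) (T : measurableType d)
    (P : probability T R) (Y : {RV P >-> R}) (p1 q x : R) (n r : nat)
    (hp1 : 0 < p1 < 1) (hY : geometric_rv Y p1)
    (hq : 0 < q < 1) (hx : 0 <= x <= 1) (hrn : (r <= n)%N) :
  (-1) ^+ (n - r) * qbernstein Y r n x q =
  qnum q x ^+ r * 'C(n, r)%:R *
    frobenius_euler (1 - qnum q^-1 x) (1 - p1) (n - r).
Proof.
rewrite -qnum_compl//; set s := qnum q (1 - x).
have s01 : 0 <= s <= 1.
  by apply: qnum_itv => //; case/andP: hx => x0 x1; rewrite subr_ge0 x1 gerBl.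
have [[p0 p1'] [s0 _]] := (andP hp1, andP s01).
have q10 : 0 <= 1 - p1 by rewrite subr_ge0 ltW.
have near1 : \forall v \near (0 : R), (1 - p1) * expR v < 1.
  by apply: near0_mul_expR_lt1; rewrite gtrBl.
pose g v := (p1 * expR v / (1 - (1 - p1) * expR v)) `^ s.
(* Only the existence of [h] matters: both sides of the theorem are expressed through the same
   [h]. *)
have [h gh] : exists h, has_egf 0 g h.
  eexists; apply: (@has_egf_expR_series _
    (fun j => p1 `^ s * rising_binomial s j * (1 - p1) ^+ j)
    (fun j => s + j%:R)).
  - by move=> j; rewrite !mulr_ge0 ?powR_ge0 ?rising_binomial_ge0 ?exprn_ge0.
  - by move=> j; rewrite addr_ge0.
  - by move: near1; apply: filterS => v; exact: cvg_negative_binomial_mgf.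
have Bgf : has_egf r (qbernstein_gf Y r x q)
    (fun k => qnum q x ^+ r * 'C(k, r)%:R * h (k - r)%N).
  apply: has_egf_near (has_egf_mul_monomial r (qnum q x) gh).
  move: near1; apply: filterS => v v1.
  by rewrite /qbernstein_gf (mmt_gen_fun_geometric hp1).
have Fgf : has_egf 0 (frobenius_euler_gf s (1 - p1)) (fun k => (-1) ^+ k * h k).
  (* This equality holds for every argument: where e^w = 1 - p1, both bases are 0 by the convention
     for division by 0. *)
  rewrite (_ : frobenius_euler_gf s (1 - p1) = fun v => g (- v)).
    exact: has_egf_opp.
  apply/funext => w; rewrite /g /frobenius_euler_gf expRN; congr (_ `^ _).
  have -> : expR w - (1 - p1) = expR w * (1 - (1 - p1) / expR w).
    by rewrite mulrBr mulr1 mulrCA divff ?mulr1// gt_eqF// expR_gt0.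
  by rewrite invfM mulrA subKr.
rewrite /qbernstein (egf_coefE Bgf)// /frobenius_euler (egf_coefE Fgf)//.
ring.
Qed.
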